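(* Let $n\ge1$, $0<\alpha<n$ and $0<q<\infty$. Then there exists a positive constant $C$, depending only on $n$, $q$ and $\alpha$, such that for every nonnegative Borel measure $\mu$ on $\mathbf{R}^n$, every $\lambda>0$ and every $0<\epsilon<1$, $$\bigl|\{x\in\mathbf{R}^n : \mathcal{T}(\mu)(x)>2\lambda,\ \mathcal{M}_\alpha(\mu)(x)\le\epsilon\lambda\}\bigr|\le C\,2^{-\frac{\alpha}{\epsilon^q}(2^q-1)}\,\bigl|\{x\in\mathbf{R}^n : \mathcal{T}(\mu)(x)>\lambda\}\bigr| .$$
   Context: $|E|$ denotes Lebesgue measure. For $k\in\mathbf{Z}$, $\mathcal{Q}_k$ is the collection of dyadic cubes of side length $2^k$, i.e. the translates of $[0,2^k)^n$ by $2^k m$, $m\in\mathbf{Z}^n$, and $\mathcal{Q}=\bigcup_{k\in\mathbf{Z}}\mathcal{Q}_k$ is the dyadic lattice; $\ell(Q)$ is the side length of $Q$. For a nonnegative Borel measure $\mu$, the dyadic nonlinear potential and the dyadic fractional maximal operator are $$\mathcal{T}(\mu)(x)=\Bigl\{\sum_{x\in Q\in\mathcal{Q}}\Bigl(\frac{\mu(Q)}{\ell(Q)^{n-\alpha}}\Bigr)^q\Bigr\}^{1/q},\qquad \mathcal{M}_\alpha(\mu)(x)=\sup_{x\in Q\in\mathcal{Q}}\frac{\mu(Q)}{\ell(Q)^{n-\alpha}}.$$ *)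

(* Defs.v *)
From HB Require Import structures.
From mathcomp Require Import all_boot all_order all_algebra.
From mathcomp Require Import all_classical all_reals all_analysis.

Set Implicit Arguments.
Unset Strict Implicit.
Unset Printing Implicit Defensive.
Import Order.TTheory GRing.Theory Num.Theory.
Import numFieldNormedType.Exports.

Local Open Scope classical_set_scope.
Local Open Scope ring_scope.

(* R^n as a measurable space: the sigma-algebra that the library puts on
   n-tuples is the one generated by the coordinate projections, that is the
   Borel sigma-algebra of R^n. *)
Notation Rn R n := (n.-tuple (measurableTypeR R)).

Section lebesgue_measure_Rn.
Context {R : realType}.
Local Open Scope ereal_scope.

Definition cons_pair n (p : measurableTypeR R * Rn R n) : Rn R n.+1 :=
  [tuple of p.1 :: p.2].

Lemma measurable_cons_pair n :
  measurable_fun [set: measurableTypeR R * Rn R n] (@cons_pair n).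
Proof. exact: measurable_cons. Qed.

Definition uncons n (x : Rn R n.+1) : measurableTypeR R * Rn R n :=
  (thead x, [tuple of behead x]).

Lemma uncons_consK n : cancel (@cons_pair n) (@uncons n).
Proof.
by move=> [a t]; rewrite /uncons /cons_pair theadE; congr pair; exact: val_inj.
Qed.

Lemma measurable_uncons n : measurable_fun [set: Rn R n.+1] (@uncons n).
Proof.
apply/measurable_fun_pairP; split.
- exact: (@measurable_tnth _ (measurableTypeR R) n.+1 ord0).
- exact: measurable_behead.
Qed.

Section succ.
Context {n : nat} (m : {sigma_finite_measure set (Rn R n) -> \bar R}).

Definition lebesgue_succ : set (Rn R n.+1) -> \bar R :=
  pushforward (@lebesgue_measure R \x m) (@cons_pair n).

Let mcons (A : set (Rn R n.+1)) :
  measurable A -> measurable (@cons_pair n @^-1` A).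
Proof. by move=> mA; rewrite -[X in measurable X]setTI; exact: measurable_cons_pair. Qed.

Let lebesgue_succ0 : lebesgue_succ set0 = 0.
Proof. by rewrite /lebesgue_succ /pushforward preimage_set0 measure0. Qed.

Let lebesgue_succ_ge0 A : 0 <= lebesgue_succ A.
Proof. exact: (measure_ge0 (@lebesgue_measure R \x m)). Qed.

Let lebesgue_succ_sigma_additive : semi_sigma_additive lebesgue_succ.
Proof.
move=> F mF tF mUF; rewrite /lebesgue_succ /pushforward preimage_bigcup.
apply: (@measure_semi_sigma_additive _ _ _ (@lebesgue_measure R \x m)).
- by move=> i; exact: mcons.
- apply/trivIsetP => /= i j _ _ ij; rewrite -preimage_setI.
  by move/trivIsetP : tF => /(_ _ _ _ _ ij) ->//; rewrite preimage_set0.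
- by rewrite -preimage_bigcup; exact: mcons.
Qed.

HB.instance Definition _ := isMeasure.Build _ _ _ lebesgue_succ
  lebesgue_succ0 lebesgue_succ_ge0 lebesgue_succ_sigma_additive.

Let lebesgue_succ_sigma_finite : sigma_finite setT lebesgue_succ.
Proof.
have /sigma_finiteP[F [TF ndF Foo]] := sigma_finiteT (@lebesgue_measure R).
have /sigma_finiteP[G [TG ndG Goo]] := sigma_finiteT m.
exists (fun k => @uncons n @^-1` (F k `*` G k)).
  rewrite -preimage_bigcup -(preimage_setT (@uncons n)); congr (_ @^-1` _).
  rewrite -setXTT TF TG predeqE => -[x y]; split; last first.
    by move=> [k _ []/= ? ?]; split; exists k.
  move=> [/= [k _ Fkx] [l _ Gly]]; exists (maxn k l) => //; split.
  - by move: x Fkx; exact/subsetPset/ndF/leq_maxl.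
  - by move: y Gly; exact/subsetPset/ndG/leq_maxr.
move=> k; have [mF Fk] := Foo k; have [mG Gk] := Goo k; split.
  rewrite -[X in measurable X]setTI; apply: measurable_uncons => //.
  exact: measurableX.
rewrite /lebesgue_succ /pushforward -comp_preimage (_ : _ \o _ = id); last first.
  by apply/funext => p; exact: uncons_consK.
by rewrite preimage_id product_measure1E// lte_mul_pinfty// ge0_fin_numE.
Qed.

HB.instance Definition _ := Measure_isSigmaFinite.Build _ _ _ lebesgue_succ
  lebesgue_succ_sigma_finite.

End succ.

(* n-dimensional Lebesgue measure on Borel sets: the n-fold product of
   one-dimensional Lebesgue measure. *)
Fixpoint lebesgue_Rn (n : nat) : {sigma_finite_measure set (Rn R n) -> \bar R} :=
  if n is n'.+1 then lebesgue_succ (lebesgue_Rn n')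
  else \d_([tuple] : Rn R 0).

(* The value on boxes, which determines the measure uniquely. *)
Lemma lebesgue_Rn_box (n : nat) (A : 'I_n -> set (measurableTypeR R)) :
  (forall i, measurable (A i)) ->
  lebesgue_Rn n [set x | forall i, A i (tnth x i)] =
  \prod_(i < n) lebesgue_measure (A i).
Proof.
elim: n A => [|n IHn] A mA.
  by rewrite big_ord0 /= diracE mem_set//= => -[].
have mB : measurable [set x : Rn R n | forall i, A (lift ord0 i) (tnth x i)].
  rewrite (_ : [set x : Rn R n | _] = \big[setI/setT]_(i < n)
      ((fun x : Rn R n => tnth x i) @^-1` A (lift ord0 i))); last first.
    rewrite -bigcap_seq; apply/seteqP; split => x /= Hx i.
      by move=> _; exact: Hx.
    by apply: Hx; rewrite /= mem_index_enum.
  apply: bigsetI_measurable => i _; rewrite -[X in measurable X]setTI.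
  exact: (@measurable_tnth _ (measurableTypeR R)).
rewrite big_ord_recl -IHn // /= /lebesgue_succ /pushforward.
rewrite -product_measure1E//; congr (_ _).
apply/seteqP; split => [[a t]|[a t]] /=.
  move=> H; split; first exact: (H ord0).
  by move=> i; have := H (lift ord0 i); rewrite tnthS.
move=> [Ha Ht] i; have [j ->|->//] := unliftP ord0 i.
by rewrite tnthS.
Qed.

End lebesgue_measure_Rn.

Section dyadic.
Context {R : realType} {n : nat}.

(* The pair (k, m) stands for the dyadic cube 2^k m + [0, 2^k)^n. For n >= 1
   distinct pairs give distinct cubes, so a sum or supremum over dyadic cubes
   is one over pairs (for n = 0 it would not be). *)
Definition dyadic : Type := (int * n.-tuple int)%type.

Definition dyadic_side (Q : dyadic) : R := 2 ^ Q.1.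

Definition dyadic_cube (Q : dyadic) : set (Rn R n) :=
  [set x | forall i, dyadic_side Q * (tnth Q.2 i)%:~R <= (tnth x i : R)
                     < dyadic_side Q * (tnth Q.2 i)%:~R + dyadic_side Q].

Definition cubes_at (x : Rn R n) : set dyadic := [set Q | dyadic_cube Q x].

Variables (alpha q : R) (mu : {measure set (Rn R n) -> \bar R}).
Local Open Scope ereal_scope.

Definition dyadic_ratio (Q : dyadic) : \bar R :=
  mu (dyadic_cube Q) * ((dyadic_side Q `^ (n%:R - alpha))^-1)%:E.

Definition dyadic_potential (x : Rn R n) : \bar R :=
  (\esum_(Q in cubes_at x) dyadic_ratio Q `^ q) `^ q^-1.

Definition dyadic_maximal (x : Rn R n) : \bar R :=
  ereal_sup [set dyadic_ratio Q | Q in cubes_at x].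

End dyadic.

(* Main.v *)
Require Import Defs.
From mathcomp Require Import all_boot all_order all_algebra.
From mathcomp Require Import all_classical all_reals all_analysis.
From mathcomp Require Import lra ring zify.
Import Order.TTheory GRing.Theory Num.Theory.
Import numFieldNormedType.Exports.
Local Open Scope classical_set_scope.
Local Open Scope ring_scope.

(* Put A := (2^q - 1) / eps^q. If the superlevel set {T > lambda} has infinite
   measure there is nothing to prove; otherwise it is the disjoint union of the
   maximal cubes P whose ancestors (P included) carry energy sum ratio^q greater
   than lambda^q. Strict ancestors of P contribute at most lambda^q, so at a bad
   point x of P the cubes Q with x in Q and Q inside P carry energy at least
   (2^q - 1) lambda^q, with every ratio at most eps lambda. If moreover the
   density mu Q / |Q| stayed below 2^(alpha m) eps lambda / l(P)^alpha, the cube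
   at depth j below P would have ratio at most
   eps lambda min(1, 2^(alpha (m - j))), and the energy would be at most
   (eps lambda)^q (m + 1 / (1 - 2^(- alpha q))); for m = A - O(1) this is too
   little. So the bad part of P lies where the dyadic maximal density of mu
   is large, and the weak (1,1) inequality bounds it by 2^(- alpha m) |P|. *)

(** * Geometry of dyadic cubes: nesting, volume, maximal subfamilies *)

Section dyadic_geometry.
Set Implicit Arguments.
Context {R : realType} {n : nat}.
Implicit Types (P Q : @dyadic n) (x y : Rn R n) (k : int).

Lemma dyadic_side_gt0 Q : 0 < dyadic_side Q :> R.
Proof. exact: exprz_gt0. Qed.

(** In units of the side of [P], the endpoints of both cubes are integers; a common point gives
    strict inequalities between integers, which sharpen to inclusion in each coordinate. *)
Lemma dyadic_cube_nested P Q x : dyadic_cube P x -> dyadic_cube Q x ->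
  (P.1 <= Q.1)%R -> dyadic_cube P `<=` (dyadic_cube Q : set (Rn R n)).
Proof.
move=> Px Qx PQ y Py i.
have [N QN] : exists N : nat, Q.1 = P.1 + N%:Z by exists `|Q.1 - P.1|%N; lia.
have sE : dyadic_side Q = dyadic_side P * (2 ^+ N)%:~R :> R.
  by rewrite /dyadic_side QN expfzDr// rmorphXn.
have := dyadic_side_gt0 P; have := Qx i; have := Px i; have := Py i.
rewrite {}sE; move: (dyadic_side P) (2 ^+ N) (tnth P.2 i) (tnth Q.2 i) => s z a b.
move: (tnth x i : R) (tnth y i : R) => u v /andP[av va] /andP[au ua] /andP[bu ub] s0.
have h1 : z * b <= a.
  rewrite -ltzD1 -(ltr_int R) rmorphD rmorphM /= -(ltr_pM2l s0).
  by apply: le_lt_trans (lt_le_trans ua _); [lra|lra].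
have h2 : a + 1 <= z * (b + 1).
  rewrite -ltzD1 ltrD2r -(ltr_int R) rmorphM rmorphD /= -(ltr_pM2l s0).
  by apply: le_lt_trans au (lt_le_trans ub _); lra.
have := ler_wpM2l (ltW s0) (etrans (ler_int R _ _) h1).
have := ler_wpM2l (ltW s0) (etrans (ler_int R _ _) h2).
rewrite !rmorphM !rmorphD/=.
by move=> ? ?; apply/andP; split; lra.
Qed.

Lemma dyadic_cube_inj P Q x : dyadic_cube P x -> dyadic_cube Q x ->
  P.1 = Q.1 -> P = Q.
Proof.
case: P Q => [k a] [l b] Px Qx /= kl; rewrite -{l}kl in Qx *; congr pair.
apply: eq_from_tnth => i; have := Px i; have := Qx i => /=.
have : 0 < 2 ^ k :> R by exact: exprz_gt0.
rewrite /dyadic_side/=; move: (2 ^ k) => s s0 /andP[bx xb] /andP[ax xa].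
have h1 : tnth b i < tnth a i + 1.
  by rewrite -(ltr_int R) rmorphD/= -(ltr_pM2l s0); lra.
have h2 : tnth a i < tnth b i + 1.
  by rewrite -(ltr_int R) rmorphD/= -(ltr_pM2l s0); lra.
by lia.
Qed.

Definition dyadic_at k x : @dyadic n :=
  (k, [tuple Num.floor ((tnth x i : R) / 2 ^ k) | i < n]).

Lemma dyadic_atP k x : dyadic_cube (dyadic_at k x) x.
Proof.
move=> i; rewrite /dyadic_side /= tnth_mktuple.
have s0 : 0 < 2 ^ k :> R by exact: exprz_gt0.
have /andP[] := floor_itv ((tnth x i : R) / 2 ^ k).
rewrite ler_pdivlMr// ltr_pdivrMr// rmorphD/= => *.
by apply/andP; split; lra.
Qed.

Lemma dyadic_cubeE Q : dyadic_cube Q =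
  [set x : Rn R n | forall i, `[dyadic_side Q * (tnth Q.2 i)%:~R,
     dyadic_side Q * (tnth Q.2 i)%:~R + dyadic_side Q[%classic (tnth x i : R)].
Proof.
by apply/seteqP; split => x Qx i; move: (Qx i); rewrite /= in_itv.
Qed.

Lemma measurable_dyadic_cube Q : measurable (dyadic_cube Q : set (Rn R n)).
Proof.
rewrite dyadic_cubeE [X in measurable X](_ : _ = \big[setI/setT]_(i < n)
    ((fun x : Rn R n => tnth x i) @^-1`
     `[dyadic_side Q * (tnth Q.2 i)%:~R,
       dyadic_side Q * (tnth Q.2 i)%:~R + dyadic_side Q[%classic)); last first.
  rewrite -bigcap_seq; apply/seteqP; split => x /= Hx i; first by move=> _; exact: Hx.
  by apply: Hx; rewrite /= mem_index_enum.
apply: bigsetI_measurable => i _; rewrite -[X in measurable X]setTI.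
exact: (@measurable_tnth _ (measurableTypeR R)).
Qed.

Lemma lebesgue_dyadic_cube Q :
  lebesgue_Rn n (dyadic_cube Q) = (dyadic_side Q ^+ n : R)%:E.
Proof.
rewrite dyadic_cubeE (lebesgue_Rn_box (A := fun i => `[dyadic_side Q * (tnth Q.2 i)%:~R,
     dyadic_side Q * (tnth Q.2 i)%:~R + dyadic_side Q[%classic)); last first.
  by move=> i; exact: measurable_itv.
under eq_bigr => i _.
  rewrite lebesgue_measure_itv /= lte_fin ltrDl dyadic_side_gt0 -EFinD addrAC subrr add0r.
  over.
by rewrite prodEFin prodr_const card_ord.
Qed.

Lemma measurable_bigcup_dyadic (D : set (@dyadic n)) :
  measurable (\bigcup_(Q in D) dyadic_cube Q : set (Rn R n)).
Proof.
rewrite bigcup_mkcond; apply: countable_bigcupT_measurable => [|Q].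
  exact: countableP.
by case: ifP => _; [exact: measurable_dyadic_cube|exact: measurable0].
Qed.

(** Countable additivity; this sums both the weak type bound and the local good-lambda bound over
    disjoint maximal cubes. *)
Lemma le_measure_bigcup_dyadic (m1 m2 : {measure set (Rn R n) -> \bar R})
    (c : R) (D : set (@dyadic n)) : 0 <= c ->
  trivIset D (dyadic_cube : _ -> set (Rn R n)) ->
  (forall Q, D Q -> (m1 (dyadic_cube Q) <= c%:E * m2 (dyadic_cube Q))%E) ->
  (m1 (\bigcup_(Q in D) dyadic_cube Q) <=
   c%:E * m2 (\bigcup_(Q in D) dyadic_cube Q))%E.
Proof.
move=> c0 tD le12.
have [enc [dec [encK decK]]] : exists (enc : @dyadic n -> nat)
    (dec : nat -> option (@dyadic n)), pcancel enc dec /\ ocancel dec enc.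
  exists (@pickle (int * n.-tuple int)%type).
  exists (@pickle_inv (int * n.-tuple int)%type); split.
  - exact: pickleK_inv.
  - exact: pickle_invK.
pose F (i : nat) : set (Rn R n) :=
  if dec i is Some Q then if Q \in D then dyadic_cube Q else set0 else set0.
have FE : \bigcup_(Q in D) dyadic_cube Q = \bigcup_i F i.
  apply/seteqP; split => [x [Q DQ Qx]|x [i _]].
    by exists (enc Q) => //; rewrite /F encK mem_set.
  rewrite /F; case: (dec i) => // Q; case: ifP => // /set_mem DQ Qx.
  by exists Q.
have mF i : measurable (F i).
  rewrite /F; case: (dec i) => [Q|]; last exact: measurable0.
  by case: ifP => _; [exact: measurable_dyadic_cube|exact: measurable0].
(* Overlapping terms decode to the same pair, and [decK] recovers each index from its decoded
   pair. *)
have tF : trivIset setT F.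
  move=> i j _ _ [x []]; rewrite /F.
  case Ei: (dec i) => [P|//]; case: ifP => // /set_mem DP Px.
  case Ej: (dec j) => [Q|//]; case: ifP => // /set_mem DQ Qx.
  have PQ : P = Q by apply: tD => //; exists x.
  by have := decK i; have := decK j; rewrite Ei Ej /= PQ => -> ->.
rewrite FE !measure_bigcup// -nneseriesZl; last by move=> i _; exact: (measure_ge0 m2).
apply: lee_nneseries => [//|i _].
rewrite /F; case: (dec i) => [Q|]; last by rewrite !measure0 mule0.
by case: ifP => [/set_mem/le12//|_]; rewrite !measure0 mule0.
Qed.

(** Maximality is tested on levels rather than on sets, so distinct maximal pairs are disjoint even
    for [n = 0], where all pairs describe the same set. *)
Definition maximal_dyadic (G : set (@dyadic n)) : set (@dyadic n) :=
  [set P | G P /\ forall Q, G Q ->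
     dyadic_cube P `<=` (dyadic_cube Q : set (Rn R n)) -> (Q.1 <= P.1)%R].

Lemma trivIset_maximal_dyadic (G : set (@dyadic n)) :
  trivIset (maximal_dyadic G) (dyadic_cube : _ -> set (Rn R n)).
Proof.
move=> P Q [GP maxP] [GQ maxQ] [x [Px Qx]].
apply: (dyadic_cube_inj Px Qx); apply/eqP; rewrite eq_le; apply/andP; split.
  case/orP: (le_total P.1 Q.1) => [//|QP].
  by apply: maxQ => //; exact: dyadic_cube_nested Qx Px QP.
case/orP: (le_total Q.1 P.1) => [//|PQ].
by apply: maxP => //; exact: dyadic_cube_nested Px Qx PQ.
Qed.

(** A non-maximal cube lies in a member of higher level; the climb stops because levels are at most
    [k], and [j] bounds the steps left. *)
Lemma bigcup_maximal_dyadic (G : set (@dyadic n)) k :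
  (forall Q, G Q -> (Q.1 <= k)%R) ->
  \bigcup_(Q in maximal_dyadic G) dyadic_cube Q =
  \bigcup_(Q in G) dyadic_cube Q :> set (Rn R n).
Proof.
move=> Gk; apply/seteqP; split => [x [Q [GQ _] Qx]|x [Q GQ Qx]]; first by exists Q.
have [j] : exists j : nat, (k <= Q.1 + j%:Z)%R.
  by exists `|k - Q.1|%N; have := Gk _ GQ; lia.
elim: j Q GQ Qx => [|j IH] Q GQ Qx kQ.
  exists Q => //; split => // Q' GQ' _.
  by apply: le_trans (Gk _ GQ') _; rewrite addr0 in kQ.
have [DQ|] := pselect (maximal_dyadic G Q); first by exists Q.
move=> /not_andP[//|] /existsNP[Q' /not_implyP[GQ' /not_implyP[QQ' /negP]]].
rewrite -ltNge => ltQ; apply: (IH Q') => //; first exact: QQ'.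
by lia.
Qed.

End dyadic_geometry.
Arguments maximal_dyadic R {n} G _.

(** * Inequalities for sums and real powers *)

Section real_bounds.
Context {R : realType}.
Set Implicit Arguments.

Lemma esum_subset (T : choiceType) (A B : set T) (a : T -> \bar R) :
  A `<=` B -> (\esum_(i in A) a i <= \esum_(i in B) a i)%E.
Proof.
move=> AB; apply: ereal_sup_le; apply: image_subset => X [finX XA].
by split => //; exact: subset_trans AB.
Qed.

Lemma lt_poweRV (l q : R) (y : \bar R) : 0 < l -> 0 < q -> (0 <= y)%E ->
  (l%:E < y `^ q^-1)%E = ((l `^ q)%:E < y)%E.
Proof.
move=> l0 q0; have qV0 : 0 < q^-1 by rewrite invr_gt0.
case: y => [y||]// y0; last by rewrite poweRyr ?gt_eqF// !ltry.
rewrite poweR_EFin !lte_fin; rewrite lee_fin in y0.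
have yE : y = (y `^ q^-1) `^ q by rewrite -powRrM mulVf ?gt_eqF// powRr1.
apply/idP/idP => [ly|].
  by rewrite [ltRHS]yE gt0_ltr_powR// nnegrE ?powR_ge0// ltW.
have lE : l = (l `^ q) `^ q^-1 by rewrite -powRrM mulfV ?gt_eqF// powRr1// ltW.
by move=> ly; rewrite [ltLHS]lE gt0_ltr_powR// nnegrE ?powR_ge0// ltW.
Qed.

Lemma powRN_lt1 (a s : R) : 1 < a -> 0 < s -> a `^ (- s) < 1.
Proof.
move=> a1 s0; have a0 : 0 < a by exact: lt_trans a1.
rewrite powRN invf_lt1 ?powR_gt0//.
have := gt0_ltr_powR s0 (ler01 : 1 \is Num.nneg) (ltW a0 : a \is Num.nneg) a1.
by rewrite powR1.
Qed.

Lemma sum_truncated_geometric_le (rho : R) (m N : nat) : 0 < rho < 1 ->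
  \sum_(0 <= j < N) (if (j < m)%N then 1 else rho ^+ (j - m)) <=
  m%:R + (1 - rho)^-1.
Proof.
move=> /andP[rho0 rho1]; pose g j := if (j < m)%N then 1 else rho ^+ (j - m).
have g0 j : 0 <= g j by rewrite /g; case: ifP => // _; exact/exprn_ge0/ltW.
(* Lengthening the sum to [m + N] terms allows a split at [m] whatever the order of [m] and [N]. *)
apply: (@le_trans _ _ (\sum_(0 <= j < m + N) g j)).
  by rewrite addnC [leRHS](@big_cat_nat _ _ _ N)//= ?leq_addr// lerDl sumr_ge0.
rewrite (@big_cat_nat _ _ _ m)//= ?leq_addr//; apply: lerD.
  rewrite (eq_big_nat _ _ (F2 := fun=> 1)) ?sumr_const_nat ?subn0//.
  by move=> j /= jm; rewrite /g jm.
rewrite -{1}[m]add0n big_addn addnC addnK.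
rewrite (eq_big_nat _ _ (F2 := geometric 1 rho)); last first.
  by move=> j _; rewrite /g /geometric /= ltnNge leq_addl/= addnK mul1r.
have := @geometric_le_lim R N 1 rho ler01 rho0.
by rewrite (ger0_norm (ltW rho0)) div1r; exact.
Qed.

End real_bounds.

(** * Energy along chains of cubes, weak type bound and local good-lambda estimate *)

Section potential.
Context {R : realType} {n : nat} (alpha q : R) (mu : {measure set (Rn R n) -> \bar R}).
Set Implicit Arguments.
Implicit Types (P Q : @dyadic n) (x : Rn R n).
Local Open Scope ereal_scope.

Local Notation ratio := (dyadic_ratio alpha mu).

Lemma dyadic_ratio_ge0 Q : 0 <= ratio Q.
Proof. by rewrite /dyadic_ratio mule_ge0// lee_fin invr_ge0 powR_ge0. Qed.

(** The share of the energy sum common to all points of [Q], with [Q] itself included. *)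
Definition ancestor_energy Q : \bar R :=
  \esum_(Q' in [set Q' | dyadic_cube Q `<=` (dyadic_cube Q' : set (Rn R n))])
    ratio Q' `^ q.

(** If the energy at [x] exceeds [l ^ q], so does a finite subsum; its cubes all contain the cube
    around [x] at their lowest level. *)
Lemma superlevelE (l : R) : (0 < l)%R -> (0 < q)%R ->
  [set x | l%:E < dyadic_potential alpha q mu x] =
  \bigcup_(Q in [set Q | (l `^ q)%:E < ancestor_energy Q]) dyadic_cube Q.
Proof.
move=> l0 q0; apply/seteqP; split => [x /=|x [Q /= lQ Qx]];
  rewrite /= lt_poweRV//; try by apply: esum_ge0 => *; exact: poweR_ge0.
  move=> /ereal_sup_gt[_ [X [/finite_seqP[s ->] sx] <-] ls].
  have [k ks] : exists k : int, forall Q, Q \in s -> (k <= Q.1)%R.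
    elim: s {sx ls} => [|Q s [k ks]]; first by exists 0%R.
    exists (Num.min k Q.1) => Q'; rewrite inE => /orP[/eqP->|/ks kQ'].
      by rewrite ge_min lexx orbT.
    by rewrite ge_min kQ'.
  exists (dyadic_at k x); last exact: dyadic_atP.
  apply: lt_le_trans ls _; apply: ereal_sup_ubound; exists [set` s] => //.
  split => // Q Qs /=.
  by apply: dyadic_cube_nested (dyadic_atP _ _) (sx _ Qs) _; exact: ks.
apply: lt_le_trans lQ _; apply: esum_subset => Q' /= QQ'; exact: QQ'.
Qed.

Lemma measurable_superlevel (l : R) : (0 < l)%R -> (0 < q)%R ->
  measurable [set x | l%:E < dyadic_potential alpha q mu x].
Proof. by move=> *; rewrite superlevelE//; exact: measurable_bigcup_dyadic. Qed.

Lemma measurable_sublevel_maximal (b : R) :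
  measurable [set x | dyadic_maximal alpha mu x <= b%:E].
Proof.
rewrite [X in measurable X](_ : _ =
  ~` \bigcup_(Q in [set Q | b%:E < ratio Q]) dyadic_cube Q).
  by apply: measurableC; exact: measurable_bigcup_dyadic.
apply/seteqP; split => x /=.
  move=> xb [Q /= bQ Qx]; have : ratio Q <= b%:E.
    by apply: le_trans xb; apply: ereal_sup_ubound; exists Q.
  by rewrite leNgt bQ.
move=> xb; apply: ge_ereal_sup => _ [Q Qx <-]; rewrite leNgt; apply/negP => bQ.
by apply: xb; exists Q.
Qed.

(** Exactly one cube around [x] sits at each depth [j] below [P]: the depths below [m] cost [b ^ q]
    each, the deeper ones decay geometrically. *)
Lemma descendant_energy_le P x (b : R) (m : nat) :
  (0 < q)%R -> (0 < alpha)%R -> (0 <= b)%R ->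
  (forall Q, dyadic_cube Q x -> ratio Q <= b%:E) ->
  (forall Q, dyadic_cube Q x -> (Q.1 <= P.1)%R ->
    ratio Q <= (b * 2 `^ (alpha * (Q.1 - P.1 + m%:Z)%:~R))%:E) ->
  \esum_(Q in cubes_at x `&` [set Q | (Q.1 <= P.1)%R]) ratio Q `^ q <=
  (b `^ q * (m%:R + (1 - 2 `^ (- (alpha * q)))^-1))%:E.
Proof.
move=> q0 alpha0 b0 rb rd.
pose e (j : nat) := dyadic_at (P.1 - j%:Z) x.
pose rho : R := (2 `^ (- (alpha * q)))%R.
have rho01 : (0 < rho < 1)%R.
  by rewrite powR_gt0//= powRN_lt1 ?ltr1n ?mulr_gt0//.
rewrite (@reindex_esum _ _ _ setT _ e); last first.
  split => [j _|i j _ _ [] |Q [/= Qx QP]].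
  - by split; [exact: dyadic_atP|rewrite /= /e /=; lia].
  - by lia.
  - exists `|P.1 - Q.1|%N => //.
    by apply: dyadic_cube_inj (dyadic_atP _ _) Qx _; rewrite /=; lia.
rewrite -nneseries_esumT; last by move=> j; exact: poweR_ge0.
apply: lime_le; first by apply: is_cvg_nneseries => *; exact: poweR_ge0.
apply: nearW => N /=.
have := ler_wpM2l (powR_ge0 b q) (@sum_truncated_geometric_le R rho m N rho01).
rewrite -lee_fin; apply: le_trans.
rewrite mulr_sumr -sumEFin; apply: lee_sum => j _.
have ejx : dyadic_cube (e j) x by exact: dyadic_atP.
have mono (c : R) : (0 <= c)%R -> ratio (e j) <= c%:E -> ratio (e j) `^ q <= (c `^ q)%:E.
  move=> c0 rc; rewrite -poweR_EFin.
  by apply: (gt0_ler_poweR (ltW q0)) rc; rewrite in_itv/= ?dyadic_ratio_ge0 ?lee_fin ?c0 leey.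
case: ltnP => jm; first by rewrite mulr1; exact/mono/rb.
apply: le_trans (mono _ _ (rd _ ejx _)) _.
- by rewrite mulr_ge0// powR_ge0.
- by rewrite /e/=; lia.
rewrite lee_fin powRM ?powR_ge0// ler_wpM2l ?powR_ge0//.
rewrite -powRrM -powR_mulrn ?powR_ge0// -powRrM.
rewrite le_eqVlt; apply/orP; left; apply/eqP; congr (_ `^ _)%R.
(* The natural subtraction is exact here because [m <= j]. *)
have -> : ((e j).1 - P.1 + m%:Z)%R = (- (j - m)%N%:Z)%R by rewrite /e/=; lia.
by rewrite rmorphN/=; ring.
Qed.


(** Weak (1,1) inequality for the dyadic maximal function, localized to [P]: the maximal cubes of
    the family are disjoint and have the same union, so no covering constant is lost. *)
Lemma maximal_weak_type P (c : R) : (0 <= c)%R ->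
  lebesgue_Rn n (\bigcup_(Q in [set Q | [/\ (Q.1 <= P.1)%R,
      dyadic_cube Q `<=` (dyadic_cube P : set (Rn R n)) &
      lebesgue_Rn n (dyadic_cube Q) <= c%:E * mu (dyadic_cube Q)]])
    dyadic_cube Q) <= c%:E * mu (dyadic_cube P).
Proof.
move=> c0; set G := [set Q | _].
rewrite -(@bigcup_maximal_dyadic _ _ _ P.1); last by move=> Q [].
have maxG Q : maximal_dyadic R G Q ->
    lebesgue_Rn n (dyadic_cube Q) <= c%:E * mu (dyadic_cube Q) by case=> [[]].
apply: le_trans (le_measure_bigcup_dyadic (lebesgue_Rn n) mu c c0
  (@trivIset_maximal_dyadic _ _ G) maxG) _.
apply: lee_wpmul2l; first by rewrite lee_fin.
apply: le_measure; rewrite ?inE.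
- exact: measurable_bigcup_dyadic.
- exact: measurable_dyadic_cube.
- by move=> x [Q [[_ QP _] _] /QP].
Qed.

Lemma good_lambda_cube P (lambda eps : R) :
  (0 < q)%R -> (0 < alpha)%R -> (0 < lambda)%R -> (0 < eps)%R ->
  (forall Q, (P.1 < Q.1)%R ->
    dyadic_cube P `<=` (dyadic_cube Q : set (Rn R n)) ->
    ancestor_energy Q <= (lambda `^ q)%:E) ->
  lebesgue_Rn n (dyadic_cube P `&`
    [set x | (2 * lambda)%:E < dyadic_potential alpha q mu x /\
             dyadic_maximal alpha mu x <= (eps * lambda)%:E]) <=
  (2 `^ (alpha * (Num.truncn (1 - 2 `^ (- (alpha * q)))^-1).+2%:R) *
   2 `^ (- (alpha / eps `^ q * (2 `^ q - 1))))%:E *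
  lebesgue_Rn n (dyadic_cube P).
Proof.
move=> q0 alpha0 l0 e0 parentP.
have [b bE] : exists b : R, b = (eps * lambda)%R by exists (eps * lambda)%R.
rewrite -bE; set B := [set x | _]; set c0 := ((1 - _)^-1)%R; set C := (_ * _)%R.
set A : R := ((2 `^ q - 1) / eps `^ q)%R.
have lambda2 : (0 < 2 * lambda)%R by rewrite mulr_gt0.
have mB : measurable B.
  apply: measurableI; first exact: measurable_superlevel.
  exact: measurable_sublevel_maximal.
have mP : measurable (dyadic_cube P : set (Rn R n)) by exact: measurable_dyadic_cube.
have b0 : (0 < b)%R by rewrite bE mulr_gt0.
(* Truncated subtraction: when [m = 0] the bound is the trivial one by [|P|]. *)
pose m := (Num.truncn A - (Num.truncn c0).+1)%N.
have A0 : (0 <= A)%R.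
  rewrite divr_ge0 ?powR_ge0// subr_ge0 -[leLHS](powRr0 2).
  by apply: ler_powR => //; rewrite ?ler1n// ltW.
(* The [.+2] in the constant comes from [A < truncn A + 1 <= m + truncn c0 + 2]. *)
have mC : ((2 `^ (- (alpha * m%:R)))%R <= C)%R.
  rewrite /C -powRD; last by rewrite pnatr_eq0 implybT.
  apply: ler_powR; first by rewrite ler1n.
  rewrite (_ : (alpha / _ * _ = alpha * A)%R); last by rewrite /A mulrAC mulrA.
  rewrite -mulrN -mulrN -mulrDr ler_pM2l//.
  have h1 : (A < (Num.truncn A).+1%:R)%R by exact: truncnS_gt.
  have : ((Num.truncn A).+1%:R <= (m + (Num.truncn c0).+2)%N%:R :> R)%R.
    by rewrite ler_nat /m; lia.
  by rewrite natrD; lra.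
apply: (@le_trans _ _ ((2 `^ (- (alpha * m%:R)))%:E * lebesgue_Rn n (dyadic_cube P))); last first.
  by apply: lee_wpmul2r => //; rewrite lee_fin.
have [m0|m_gt0] := posnP m.
  rewrite m0 mulr0 oppr0 powRr0 mul1e; apply: le_measure; rewrite ?inE//.
  exact: measurableI.
(* One bad point [x0] in [P] is enough to give [ratio P <= b], hence a bound on [mu P]. *)
have [->|/set0P[x0 [Px0 [_ Mx0]]]] := eqVneq (dyadic_cube P `&` B) set0.
  by rewrite measure0 mule_ge0// lee_fin powR_ge0.
have sideE Q : dyadic_side Q = (2 `^ Q.1%:~R)%R :> R by rewrite powR_intmul.
have two_neq0 : (2 != 0 :> R)%R by rewrite pnatr_eq0.
(* [c] makes [c * mu P <= 2 ^ (- alpha m) |P|] as soon as [ratio P <= b]. *)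
pose c : R := (b^-1 * 2 `^ (alpha * (P.1 - m%:Z)%:~R))%R.
have c_gt0 : (0 < c)%R by rewrite mulr_gt0 ?invr_gt0// powR_gt0.
have ratio_le_max x Q : dyadic_cube Q x ->
    dyadic_maximal alpha mu x <= b%:E -> ratio Q <= b%:E.
  by move=> Qx; apply: le_trans; apply: ereal_sup_ubound; exists Q.
have side_gt0 Q : (0 < (dyadic_side Q : R) `^ (n%:R - alpha))%R.
  by rewrite powR_gt0// dyadic_side_gt0.
have muE Q : mu (dyadic_cube Q) = ratio Q * (dyadic_side Q `^ (n%:R - alpha))%:E.
  by rewrite /dyadic_ratio -muleA -EFinM mulVf ?gt_eqF// mule1.
apply: (@le_trans _ _ (c%:E * mu (dyadic_cube P))); last first.
  rewrite muE lebesgue_dyadic_cube.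
  apply: (@le_trans _ _ (c%:E * (b%:E * (dyadic_side P `^ (n%:R - alpha))%:E))).
    apply: lee_wpmul2l; first by rewrite lee_fin ltW.
    apply: lee_wpmul2r; first by rewrite lee_fin ltW.
    exact: ratio_le_max Px0 Mx0.
  rewrite -!EFinM lee_fin /c sideE -powR_mulrn ?powR_ge0// -!powRrM.
  rewrite mulrCA mulrA mulrA mulfV ?gt_eqF// mul1r.
  rewrite -!powRD ?two_neq0 ?implybT// rmorphB/=.
  rewrite le_eqVlt; apply/orP; left; apply/eqP; congr (_ `^ _)%R; ring.
(* On the bad part of [P] some descendant has density [mu Q / |Q| >= 1 / c]:
   otherwise the ratios below [P] are at most [b], and from depth [m] on decay
   like [2 ^ (- alpha j)], so their energy is too small. *)
apply: le_trans (maximal_weak_type P c (ltW c_gt0)).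
apply: le_measure; rewrite ?inE.
- exact: measurableI.
- exact: measurable_bigcup_dyadic.
move=> x [Px [Tx Mx]]; apply: contrapT => xG.
move: Tx; apply/negP; rewrite -leNgt leNgt lt_poweRV//; last first.
  by apply: esum_ge0 => *; exact: poweR_ge0.
rewrite -leNgt (esumID [set Q | (Q.1 <= P.1)%R]); last by move=> *; exact: poweR_ge0.
rewrite (powRM _ (ler0n R 2) (ltW l0)).
(* The first share is the budget for [P] and the cubes inside it, the second for its strict
   ancestors. *)
have -> : (2 `^ q * lambda `^ q)%R =
    (lambda `^ q * (2 `^ q - 1) + lambda `^ q)%R :> R by ring.
rewrite EFinD; apply: leeD; last first.
  (* The strict ancestors of [P] are the cubes containing its parent [P'], to which [parentP]
     applies. *)
  pose P' := dyadic_at (P.1 + 1) x.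
  apply: le_trans (parentP P' _ _); last 2 first.
  - by rewrite /= ltzD1.
  - by apply: dyadic_cube_nested Px (dyadic_atP _ _) _; rewrite /= lerDl.
  apply: esum_subset => Q [Qx /negP]; rewrite -ltNge => PQ.
  by apply: dyadic_cube_nested (dyadic_atP _ _) Qx _; rewrite /= lezD1.
apply: le_trans (@descendant_energy_le P x b m q0 alpha0 (ltW b0) _ _) _.
- by move=> Q Qx; exact: ratio_le_max Mx.
- move=> Q Qx QP; rewrite leNgt; apply/negP => bQ; apply: xG.
  exists Q => //; split => //; first exact: dyadic_cube_nested Qx Px QP.
  rewrite muE lebesgue_dyadic_cube.
  (* With this [c], the decay bound for [ratio Q] turns into exactly [|Q|], by equality of the
     exponents of 2. *)
  apply: (@le_trans _ _ (c%:E * ((b * 2 `^ (alpha * (Q.1 - P.1 + m%:Z)%:~R))%:E *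
      (dyadic_side Q `^ (n%:R - alpha))%:E))); last first.
    apply: lee_wpmul2l; first by rewrite lee_fin ltW.
    by apply: lee_wpmul2r; [rewrite lee_fin ltW|exact: ltW].
  rewrite -!EFinM lee_fin /c sideE -powR_mulrn ?powR_ge0// -!powRrM.
  rewrite -!mulrA mulrCA mulKf ?gt_eqF//.
  rewrite -!powRD ?two_neq0 ?implybT// rmorphB !rmorphD rmorphN/=.
  rewrite le_eqVlt; apply/orP; left; apply/eqP; congr (_ `^ _)%R; ring.
rewrite lee_fin bE (powRM _ (ltW e0) (ltW l0)) mulrAC mulrC ler_pM2l ?powR_gt0//.
rewrite mulrC -ler_pdivlMr ?powR_gt0// -/A -/c0.
apply: le_trans (_ : (Num.truncn A)%:R <= _)%R; last by rewrite truncn_le.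
(* What remains is [m + c0 <= A]; since [m > 0], the subtraction defining [m] was exact. *)
have <- : (m + (Num.truncn c0).+1)%N = Num.truncn A.
  by rewrite subnK// ltnW// -subn_gt0.
by rewrite natrD lerD2l; exact/ltW/truncnS_gt.
Qed.

End potential.

(** * Summation of the local estimate over maximal cubes *)

Theorem theorem2p1 (R : realType) (n : nat) (alpha q : R)
    (hn : (1 <= n)%N) (halpha0 : 0 < alpha) (halphan : alpha < n%:R)
    (hq : 0 < q) :
  exists2 C : R, 0 < C &
    forall (mu : {measure set (Rn R n) -> \bar R}) (lambda eps : R),
      0 < lambda -> 0 < eps -> eps < 1 ->
      (lebesgue_Rn n
         [set x | (2 * lambda)%:E < dyadic_potential alpha q mu x /\
                  dyadic_maximal alpha mu x <= (eps * lambda)%:E]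
       <= (C * 2 `^ (- (alpha / eps `^ q * (2 `^ q - 1))))%:E
          * lebesgue_Rn n [set x | lambda%:E < dyadic_potential alpha q mu x])%E.
Proof.
exists (2 `^ (alpha * (Num.truncn (1 - 2 `^ (- (alpha * q)))^-1).+2%:R)).
  by rewrite powR_gt0.
move=> mu lambda eps l0 e0 _.
set c := (_ * _ `^ _); set B := [set x | _ /\ _]; set E := [set x | _].
have c_gt0 : 0 < c by rewrite mulr_gt0// powR_gt0.
have mE : measurable E by exact: measurable_superlevel.
have mB : measurable B.
  apply: measurableI; last exact: measurable_sublevel_maximal.
  by apply: measurable_superlevel => //; rewrite mulr_gt0.
have BE : B `<=` E.
  by move=> x [+ _]; apply: lt_trans; rewrite lte_fin ltr_pMl// ltr1n.
have [->|Efin] := eqVneq (lebesgue_Rn n E) +oo%E.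
  by rewrite gt0_muley ?lte_fin// leey.
pose v := fine (lebesgue_Rn n E).
have vE : lebesgue_Rn n E = v%:E.
  by rewrite fineK// ge0_fin_numE ?measure_ge0// ltey.
pose G := [set Q | ((lambda `^ q)%:E < ancestor_energy alpha q mu Q)%E].
have EG : E = \bigcup_(Q in G) dyadic_cube Q by exact: superlevelE.
(* Cubes of [G] lie in [E], so a level [j >= 0] satisfies [j <= 2 ^ j <= 2 ^ (j n) <= v], using
   [n >= 1]; negative levels are immediate. *)
have Gk Q : G Q -> Q.1 <= (Num.truncn v)%:Z.
  move=> GQ; have : (lebesgue_Rn n (dyadic_cube Q) <= lebesgue_Rn n E)%E.
    apply: le_measure; rewrite ?inE//; first exact: measurable_dyadic_cube.
    by rewrite EG => x Qx; exists Q.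
  rewrite vE lebesgue_dyadic_cube lee_fin /dyadic_side => Qv.
  case: Q.1 Qv => [j|j] Qv; last by lia.
  rewrite lez_nat truncn_ge_nat; last by apply: le_trans Qv; exact/exprn_ge0/exprz_ge0.
  apply: le_trans Qv; rewrite -exprnP -exprM -natrX ler_nat.
  apply: (@leq_trans (2 ^ j)%N); first exact/ltnW/ltn_expl.
  by rewrite leq_exp2l// leq_pmulr.
have BM : B = B `&` \bigcup_(Q in maximal_dyadic R G) dyadic_cube Q.
  by rewrite (bigcup_maximal_dyadic _ _ Gk) -EG; apply/esym/setIidl.
rewrite {1}BM setIC EG -(bigcup_maximal_dyadic _ _ Gk).
(* Restricting Lebesgue measure to [B] makes the volume of the bad part of [P] a measure of [P]. *)
apply: (le_measure_bigcup_dyadic (mrestr (lebesgue_Rn n) mB)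
  (lebesgue_Rn n) c (ltW c_gt0) (@trivIset_maximal_dyadic _ _ G)).
move=> P [GP maxP]; apply: good_lambda_cube => // Q PQ subPQ.
(* A strict ancestor of energy above [lambda ^ q] would be in [G], against the maximality of [P]. *)
rewrite leNgt; apply/negP => GQ.
by have := maxP _ GQ subPQ; rewrite leNgt PQ.
Qed.
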